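(* Let $k>0$ and $\mathbb{R}^2_+:=\mathbb{R}\times(0,+\infty)$. Suppose that $\tilde u\in C^2(\mathbb{R}^2_+)\cap C_b(\overline{\mathbb{R}^2_+}\setminus\{(0,0)\})$ is a solution to $$\begin{cases}\operatorname{div}\left(|\mathbf{x}|^{-k}\nabla_{\mathbf{x}}\tilde u\right)=0, & \mathbf{x}\in\mathbb{R}^2_+,\\ \tilde u(\tilde x,0)=0, & \tilde x\neq 0.\end{cases}$$ Then $\tilde u\equiv 0$.
   Context: Here $\mathbf{x}=(\tilde x,\tilde y)$ denotes a point of $\mathbb{R}^2$, $|\mathbf{x}|$ is its Euclidean norm, and $\nabla_{\mathbf{x}}$ and $\operatorname{div}$ are the gradient and the divergence with respect to $\mathbf{x}$. Functions are real-valued. $C_b(\overline{\mathbb{R}^2_+}\setminus\{(0,0)\})$ denotes the space of bounded continuous functions on the closed half-plane $\mathbb{R}\times[0,+\infty)$ with the origin removed. *)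

(* Defs.v *)
From Stdlib Require Export Reals.
From Coquelicot Require Export Coquelicot.
Open Scope R_scope.

Definition half_plane (p : R * R) : Prop := 0 < snd p.

Definition closed_half_plane_minus_origin (p : R * R) : Prop :=
  0 <= snd p /\ p <> (0, 0).

(* Coquelicot's norm on a product is the l^2 combination of the component
   norms, so on R * R it is the Euclidean norm. *)
Definition enorm (p : R * R) : R :=
  @norm R_AbsRing (prod_NormedModule R_AbsRing R_NormedModule R_NormedModule) p.

(* [Derive] is total: [grad] and [div] are meaningful where the partial
   derivatives involved exist, which the C^2 assumption guarantees. *)
Definition grad (u : R * R -> R) (p : R * R) : R * R :=
  (Derive (fun s => u (s, snd p)) (fst p), Derive (fun t => u (fst p, t)) (snd p)).

Definition div (F : R * R -> R * R) (p : R * R) : R :=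
  Derive (fun s => fst (F (s, snd p))) (fst p)
  + Derive (fun t => snd (F (fst p, t))) (snd p).

(* [ex_diff_n f 2 x y]: f and its partial derivatives of order at most 2 exist
   and are continuous at (x, y).  On an open set D this is f in C^2(D). *)
Definition C2_on (D : R * R -> Prop) (u : R * R -> R) : Prop :=
  forall p : R * R, D p -> ex_diff_n (fun x y => u (x, y)) 2 (fst p) (snd p).

(* [continuous_on] is continuity for the subspace topology of D, so the values
   of u outside D are irrelevant. *)
Definition Cb_on (D : R * R -> Prop) (u : R * R -> R) : Prop :=
  continuous_on D u /\ exists M : R, forall p : R * R, D p -> Rabs (u p) <= M.

(* Main.v *)
Require Import Defs.
From Stdlib Require Import Lra Psatz Classical IndefiniteDescription List.

(** The equation is equivalent to [u_xx + u_yy - k (x u_x + y u_y) / r^2 = 0]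
with [r^2 = x^2 + y^2], an elliptic equation whose coefficients are smooth away
from the origin.  The origin and infinity are the only places where the boundary
values of [u] are unknown, and [u] is bounded there, so a Phragmen-Lindelof
argument applies: it suffices to find a positive strict supersolution [w] that
tends to infinity both at the origin and at infinity.  Then [u - e w] attains a
maximum over the closed half-plane minus the origin whenever it is positive
somewhere.  It cannot do so on the boundary line, where [u = 0 < w], nor inside
([no_interior_max]), where the gradient would vanish, the pure second derivatives
would be nonpositive, and the strict inequality for [w] would be violated.  So
[u <= e w] for every [e > 0] ([le_barrier]), whence [u <= 0]; the same holds for
[- u].

With [L = ln (r^2)] and the polar angle [a], the barrier is
[w = (C + L^2) (8 + 8 sin a + cos (2 a))].  The operator multiplied by [r^2] sends
[F(L) h(a)] to [(4 F'' - 2 k F') h + F h''].  The angular factor lies between 9 and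
15 and [h'' <= -4] on the whole closed half-circle, so the negative term [F h''] is
quadratic in [L] while the other one grows only linearly; a large [C] takes care of
moderate [L] ([barrier_supersolution]).  The barrier is written with
[sin a = y / r], which avoids trigonometric functions.

Attainment of the maximum comes from compactness of a rectangle, for functions
that are upper semicontinuous when given the value minus infinity outside their
domain ([usc_attains_max]): this allows the origin to belong to the rectangle. *)

(** * First and second order conditions at a local maximum *)

Lemma nonzero_derivative_increase (f : R -> R) (x d : R) :
  is_derive f x d -> d <> 0 ->
  exists delta : posreal, forall h, Rabs h < delta -> 0 < d * h -> f x < f (x + h).
Proof.
  intros Hf Hd.
  apply is_derive_Reals in Hf.
  destruct (Hf (Rabs d) (Rabs_pos_lt d Hd)) as [delta Hdelta].
  exists delta; intros h Hh Hdh.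
  assert (Hh0 : h <> 0) by (intros ->; lra).
  specialize (Hdelta h Hh0 Hh).
  set (q := (f (x + h) - f x) / h) in Hdelta.
  assert (Hq : f (x + h) - f x = q * h) by (unfold q; field; exact Hh0).
  enough (0 < q * h) by lra.
  clearbody q; clear - Hdelta Hdh.
  destruct (Rle_or_lt 0 h) as [Hh | Hh].
  - assert (0 < d) by nra.
    rewrite (Rabs_pos_eq d) in Hdelta by lra.
    apply Rabs_def2 in Hdelta. nra.
  - assert (d < 0) by nra.
    rewrite (Rabs_left d) in Hdelta by lra.
    apply Rabs_def2 in Hdelta. nra.
Qed.

(** If [g x = 0] and [l > 0], then [g] is positive just to the right of [x], so
[f] increases there by the mean value theorem. *)
Lemma local_max_derivatives (f g : R -> R) (x l : R) :
  locally x (fun s => is_derive f s (g s)) -> is_derive g x l ->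
  locally x (fun s => f s <= f x) ->
  g x = 0 /\ l <= 0.
Proof.
  intros Hf Hg [dm Hmax].
  assert (Hgx : g x = 0).
  { apply NNPP; intros Hne.
    destruct (nonzero_derivative_increase f x (g x) (locally_singleton _ _ Hf) Hne)
      as [delta Hdelta].
    set (e := Rmin dm delta / 2).
    assert (He : 0 < e /\ e < dm /\ e < delta).
    { unfold e. pose proof (cond_pos dm); pose proof (cond_pos delta).
      unfold Rmin; destruct Rle_dec; lra. }
    destruct (Rdichotomy _ _ Hne) as [Hs | Hs].
    - assert (f x < f (x + - e)).
      { apply Hdelta; [rewrite Rabs_left; lra | nra]. }
      assert (f (x + - e) <= f x); [|lra].
      apply Hmax. change (Rabs (x + - e - x) < dm). rewrite Rabs_left; lra.
    - assert (f x < f (x + e)).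
      { apply Hdelta; [rewrite Rabs_pos_eq; lra | nra]. }
      assert (f (x + e) <= f x); [|lra].
      apply Hmax. change (Rabs (x + e - x) < dm). rewrite Rabs_pos_eq; lra. }
  split; [exact Hgx|].
  apply Rnot_lt_le; intros Hl.
  destruct (nonzero_derivative_increase g x l Hg) as [dg Hdg]; [lra|].
  destruct Hf as [df Hf].
  set (e := Rmin dm (Rmin df dg) / 2).
  assert (He : 0 < e /\ e < dm /\ e < df /\ e < dg).
  { unfold e. pose proof (cond_pos dm); pose proof (cond_pos df); pose proof (cond_pos dg).
    unfold Rmin; destruct (Rle_dec df dg); destruct Rle_dec; lra. }
  destruct (MVT_cor2 f g x (x + e)) as [c [Hc Hxc]]; [lra| |].
  { intros c Hc. apply is_derive_Reals, Hf.
    change (Rabs (c - x) < df). rewrite Rabs_pos_eq; lra. }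
  assert (0 < g c).
  { rewrite <- Hgx. replace c with (x + (c - x)) by ring.
    apply Hdg; [rewrite Rabs_pos_eq; lra | nra]. }
  assert (f (x + e) <= f x); [|nra].
  apply Hmax. change (Rabs (x + e - x) < dm). rewrite Rabs_pos_eq; lra.
Qed.

(** * Maxima of semicontinuous functions on a rectangle *)

Lemma finite_cover_rectangle (a b c d : R) (N : R * R -> R * R -> Prop) :
  (forall t, a <= fst t <= b -> c <= snd t <= d -> locally t (N t)) ->
  exists l : list (R * R), forall p, a <= fst p <= b -> c <= snd p <= d ->
    exists t, In t l /\ a <= fst t <= b /\ c <= snd t <= d /\ N t p.
Proof.
  intros HN.
  assert (Hd : forall t : R * R, exists delta : posreal,
    a <= fst t <= b -> c <= snd t <= d -> forall p, ball t delta p -> N t p).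
  { intros t.
    destruct (classic (a <= fst t <= b /\ c <= snd t <= d)) as [[H1 H2] | H].
    - destruct (HN t H1 H2) as [delta Hdelta]. exists delta; auto.
    - exists (mkposreal 1 Rlt_0_1). tauto. }
  destruct (functional_choice _ Hd) as [delta Hdelta].
  destruct (NNPP _ (compactness_list 2 (a, (c, tt)) (b, (d, tt))
    (fun t => delta (fst t, fst (snd t))))) as [l Hl].
  exists (map (fun t : Compactness.Tn 2 R => (fst t, fst (snd t))) l).
  intros [x y] Hx Hy; cbn [fst snd] in *.
  destruct (Hl (x, (y, tt))) as [[t1 [t2 []]] [Hin [Hb Hc]]].
  { simpl; auto. }
  simpl in Hb, Hc.
  exists (t1, t2); repeat split; try tauto.
  - apply (in_map (fun t : Compactness.Tn 2 R => (fst t, fst (snd t))) l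
      (t1, (t2, tt))), Hin.
  - apply Hdelta; [tauto | tauto |].
    split; tauto.
Qed.

Lemma list_argmax {T : Type} (f : T -> R) (l : list T) :
  l <> nil -> exists t, In t l /\ forall s, In s l -> f s <= f t.
Proof.
  induction l as [|a l IH]; [congruence|]; intros _.
  destruct l as [|b l].
  - exists a; split; [now left|]. intros s [<- | []]; lra.
  - destruct IH as [t [Ht Hmax]]; [congruence|].
    destruct (Rle_or_lt (f a) (f t)) as [H | H].
    + exists t; split; [now right|]. intros s [<- | Hs]; auto.
    + exists a; split; [now left|].
      intros s [<- | Hs]; [lra|]. specialize (Hmax s Hs); lra.
Qed.

(** The hypothesis on [f] is upper semicontinuity of its extension by minus
infinity outside [K]: at a point outside [K] it asks that [f] tend to minus
infinity along [K].  If no maximum existed, every point [t] would have a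
neighbourhood on which [f] stays below some value [f (s t)]; among the finitely
many [s t] of a subcover, the one with the largest value lies itself in one of the
neighbourhoods, hence is beaten by another. *)
Lemma usc_attains_max (a b c d : R) (K : R * R -> Prop) (f : R * R -> R) (p0 : R * R) :
  (forall t m, a <= fst t <= b -> c <= snd t <= d -> (K t -> f t < m) ->
     locally t (fun p => K p -> f p < m)) ->
  a <= fst p0 <= b -> c <= snd p0 <= d -> K p0 ->
  exists t, a <= fst t <= b /\ c <= snd t <= d /\ K t /\
    forall p, a <= fst p <= b -> c <= snd p <= d -> K p -> f p <= f t.
Proof.
  intros Husc H1 H2 HK.
  apply NNPP; intros Hno.
  set (S := fun p : R * R => a <= fst p <= b /\ c <= snd p <= d /\ K p).
  assert (Hbeat : forall t, exists s, S s /\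
    (a <= fst t <= b -> c <= snd t <= d -> K t -> f t < f s)).
  { intros t. apply NNPP; intros Ht. apply Hno.
    destruct (classic (S t)) as [[Ha [Hc Hk]] | HS].
    - exists t; repeat split; try tauto.
      intros p Hp1 Hp2 HKp. apply Rnot_lt_le; intros Hlt.
      apply Ht. exists p; unfold S; tauto.
    - exfalso. apply Ht. exists p0; unfold S in *; tauto. }
  destruct (functional_choice _ Hbeat) as [s Hs].
  destruct (finite_cover_rectangle a b c d (fun t p => K p -> f p < f (s t)))
    as [l Hl].
  { intros t Ht1 Ht2. apply Husc; auto. intros Hk. now apply Hs. }
  destruct (list_argmax (fun t => f (s t)) l) as [t [Ht Hmax]].
  { intros ->. destruct (Hl p0 H1 H2) as [t [[] _]]. }
  destruct (Hs t) as [[Hs1 [Hs2 Hs3]] _].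
  destruct (Hl (s t) Hs1 Hs2) as [t' [Ht' [_ [_ Hlt]]]].
  specialize (Hmax t' Ht'); specialize (Hlt Hs3). cbn beta in Hmax. lra.
Qed.

(** * The barrier *)

Definition radius (x y : R) : R := sqrt (x * x + y * y).
Definition logsq (x y : R) : R := ln (x * x + y * y).

Lemma sum_sq_pos x y : (x, y) <> (0, 0) -> 0 < x * x + y * y.
Proof.
  intros H. destruct (Req_dec x 0) as [-> | Hx]; [|nra].
  destruct (Req_dec y 0) as [-> | Hy]; [now elim H|nra].
Qed.

Lemma radius_sqr x y : radius x y ^ 2 = x ^ 2 + y ^ 2.
Proof. unfold radius. rewrite pow2_sqrt; nra. Qed.

Lemma radius_pos x y : 0 < x * x + y * y -> 0 < radius x y.
Proof. apply sqrt_lt_R0. Qed.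

Lemma radius_sym x y : radius x y = radius y x.
Proof. unfold radius; f_equal; ring. Qed.

Lemma logsq_sym x y : logsq x y = logsq y x.
Proof. unfold logsq; f_equal; ring. Qed.

Lemma is_derive_radius x y : 0 < x * x + y * y ->
  is_derive (fun s => radius s y) x (x / radius x y).
Proof.
  intros H. pose proof (radius_pos x y H).
  unfold radius in *; auto_derive; [tauto|]. field; lra.
Qed.

Lemma is_derive_logsq x y : 0 < x * x + y * y ->
  is_derive (fun s => logsq s y) x (2 * x / radius x y ^ 2).
Proof.
  intros H. rewrite radius_sqr.
  unfold logsq; auto_derive; [tauto|]. field; nra.
Qed.

Lemma is_derive_radius_y x y : 0 < x * x + y * y ->
  is_derive (fun t => radius x t) y (y / radius x y).
Proof.
  intros H. rewrite (radius_sym x y).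
  apply is_derive_ext with (fun t => radius t x); [intros; apply radius_sym|].
  apply is_derive_radius; lra.
Qed.

Lemma is_derive_logsq_y x y : 0 < x * x + y * y ->
  is_derive (fun t => logsq x t) y (2 * y / radius x y ^ 2).
Proof.
  intros H. rewrite (radius_sym x y).
  apply is_derive_ext with (fun t => logsq t x); [intros; apply logsq_sym|].
  apply is_derive_logsq; lra.
Qed.

(** The angular factor is [8 + 8 sin a + cos (2 a)] in terms of the polar angle
[a].  The term [cos (2 a)] is there because [sin] alone has zero second derivative
on the boundary, where strict concavity is needed too. *)
Definition barrier (C x y : R) : R :=
  let s := y / radius x y in
  (C + logsq x y ^ 2) * (9 + 8 * s - 2 * s ^ 2).

(** The derivatives are organised by the chain rule in [L] and [s], where
   [L_x = 2 x / r^2], [L_y = 2 y / r^2], [s_x = - x y / r^3], [s_y = x^2 / r^3]. *)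
Definition barrier_x (C x y : R) : R :=
  let r := radius x y in let L := logsq x y in let s := y / r in
  2 * L * (2 * x / r ^ 2) * (9 + 8 * s - 2 * s ^ 2)
  + (C + L ^ 2) * (8 - 4 * s) * (- (x * y / r ^ 3)).

Definition barrier_y (C x y : R) : R :=
  let r := radius x y in let L := logsq x y in let s := y / r in
  2 * L * (2 * y / r ^ 2) * (9 + 8 * s - 2 * s ^ 2)
  + (C + L ^ 2) * (8 - 4 * s) * (x ^ 2 / r ^ 3).

Definition barrier_xx (C x y : R) : R :=
  let r := radius x y in let L := logsq x y in let s := y / r in
  2 * (2 * x / r ^ 2) ^ 2 * (9 + 8 * s - 2 * s ^ 2)
  + 2 * L * (2 / r ^ 2 - 4 * x ^ 2 / r ^ 4) * (9 + 8 * s - 2 * s ^ 2)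
  + 4 * L * (8 - 4 * s) * (2 * x / r ^ 2) * (- (x * y / r ^ 3))
  + (C + L ^ 2) * (-4 * (x * y / r ^ 3) ^ 2
                   + (8 - 4 * s) * (3 * x ^ 2 * y / r ^ 5 - y / r ^ 3)).

Definition barrier_yy (C x y : R) : R :=
  let r := radius x y in let L := logsq x y in let s := y / r in
  2 * (2 * y / r ^ 2) ^ 2 * (9 + 8 * s - 2 * s ^ 2)
  + 2 * L * (2 / r ^ 2 - 4 * y ^ 2 / r ^ 4) * (9 + 8 * s - 2 * s ^ 2)
  + 4 * L * (8 - 4 * s) * (2 * y / r ^ 2) * (x ^ 2 / r ^ 3)
  + (C + L ^ 2) * (-4 * (x ^ 2 / r ^ 3) ^ 2
                   - (8 - 4 * s) * (3 * x ^ 2 * y / r ^ 5)).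

(* [radius] and [logsq] stay folded during differentiation, so that what remains
   is an identity between rational functions of [x], [y], [radius x y] and
   [logsq x y], modulo [radius x y ^ 2 = x ^ 2 + y ^ 2]. *)
Ltac derive_in_x x y :=
  let H := fresh in
  let Hr := fresh in
  intros H; pose proof (radius_pos x y H) as Hr;
  pose proof (is_derive_radius x y H : is_derive (fun s : R => radius s y) x _);
  pose proof (is_derive_logsq x y H : is_derive (fun s : R => logsq s y) x _);
  cbv zeta; auto_derive;
  [ repeat split; try (eexists; eassumption); apply Rgt_not_eq;
    repeat apply Rmult_lt_0_compat; lra
  | rewrite (is_derive_unique (fun s : R => radius s y) x (x / radius x y)) by assumption;
    rewrite (is_derive_unique (fun s : R => logsq s y) x (2 * x / radius x y ^ 2)) by assumption ].

Ltac derive_in_y x y :=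
  let H := fresh in
  let Hr := fresh in
  intros H; pose proof (radius_pos x y H) as Hr;
  pose proof (is_derive_radius_y x y H : is_derive (fun s : R => radius x s) y _);
  pose proof (is_derive_logsq_y x y H : is_derive (fun s : R => logsq x s) y _);
  cbv zeta; auto_derive;
  [ repeat split; try (eexists; eassumption); apply Rgt_not_eq;
    repeat apply Rmult_lt_0_compat; lra
  | rewrite (is_derive_unique (fun s : R => radius x s) y (y / radius x y)) by assumption;
    rewrite (is_derive_unique (fun s : R => logsq x s) y (2 * y / radius x y ^ 2)) by assumption;
    pose proof (radius_sqr x y) ].

Lemma is_derive_barrier_x C x y : 0 < x * x + y * y ->
  is_derive (fun s => barrier C s y) x (barrier_x C x y).
Proof.
  unfold barrier, barrier_x. derive_in_x x y.
  field; lra.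
Qed.

Lemma is_derive_barrier_xx C x y : 0 < x * x + y * y ->
  is_derive (fun s => barrier_x C s y) x (barrier_xx C x y).
Proof.
  unfold barrier_x, barrier_xx. derive_in_x x y.
  field; lra.
Qed.

Lemma is_derive_barrier_y C x y : 0 < x * x + y * y ->
  is_derive (fun t => barrier C x t) y (barrier_y C x y).
Proof.
  unfold barrier, barrier_y. derive_in_y x y.
  assert (Hx : x ^ 2 = radius x y ^ 2 - y ^ 2) by lra.
  field [Hx]; lra.
Qed.

Lemma is_derive_barrier_yy C x y : 0 < x * x + y * y ->
  is_derive (fun t => barrier_y C x t) y (barrier_yy C x y).
Proof.
  unfold barrier_y, barrier_yy. derive_in_y x y.
  assert (Hx : x ^ 2 = radius x y ^ 2 - y ^ 2) by lra.
  field [Hx]; lra.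
Qed.

(** The right-hand side is [(4 F'' - 2 k F') h + F h''] with [F = C + L^2] and [h]
the angular factor: there are no mixed terms because [s] is homogeneous of degree
zero, so its gradient is orthogonal to that of [L] and to the position vector. *)
Lemma barrier_equation k C x y : 0 < x * x + y * y ->
  let L := logsq x y in let s := y / radius x y in
  radius x y ^ 2 * (barrier_xx C x y + barrier_yy C x y)
    - k * (x * barrier_x C x y + y * barrier_y C x y)
  = (8 - 4 * k * L) * (9 + 8 * s - 2 * s ^ 2)
    - (C + L ^ 2) * (4 + 8 * s - 8 * s ^ 2).
Proof.
  intros H. pose proof (radius_pos x y H) as Hr.
  pose proof (radius_sqr x y) as Hr2.
  assert (Hx : x ^ 2 = radius x y ^ 2 - y ^ 2) by lra.
  cbv zeta. unfold barrier_x, barrier_y, barrier_xx, barrier_yy. cbv zeta.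
  field [Hx]; lra.
Qed.

Lemma sine_bounds x y : 0 <= y -> 0 < x * x + y * y -> 0 <= y / radius x y <= 1.
Proof.
  intros Hy H. pose proof (radius_pos x y H) as Hr. pose proof (radius_sqr x y).
  split.
  - apply Rdiv_le_0_compat; lra.
  - apply Rle_div_l; nra.
Qed.

Lemma barrier_supersolution k C x y :
  0 < k -> 31 + 57 * k ^ 2 <= C -> 0 <= y -> 0 < x * x + y * y ->
  barrier_xx C x y + barrier_yy C x y
  - k * (x * barrier_x C x y + y * barrier_y C x y) / (x * x + y * y) < 0.
Proof.
  intros Hk HC Hy H.
  pose proof (barrier_equation k C x y H) as E. cbv zeta in E.
  pose proof (sine_bounds x y Hy H) as Hs.
  rewrite radius_sqr in E.
  set (s := y / radius x y) in *. set (L := logsq x y) in *.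
  assert (HR : (8 - 4 * k * L) * (9 + 8 * s - 2 * s ^ 2)
               - (C + L ^ 2) * (4 + 8 * s - 8 * s ^ 2) < 0).
  (* The bound below comes down to [120 + 60 k |L| < 4 C + 4 L^2], and
     [60 k |L| <= 4 L^2 + 225 k^2]: hence the constants 31 and 57. *)
  { assert (HH : 9 <= 9 + 8 * s - 2 * s ^ 2 <= 15) by nra.
    assert (HG : 4 <= 4 + 8 * s - 8 * s ^ 2) by nra.
    assert (H1 : (8 - 4 * k * L) * (9 + 8 * s - 2 * s ^ 2)
                 <= (8 + 4 * k * Rabs L) * 15).
    { pose proof (Rle_abs (- L)) as HL. rewrite Rabs_Ropp in HL.
      pose proof (Rabs_pos L).
      apply Rle_trans with ((8 + 4 * k * Rabs L) * (9 + 8 * s - 2 * s ^ 2)).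
      - apply Rmult_le_compat_r; nra.
      - apply Rmult_le_compat_l; nra. }
    assert (H2 : (C + L ^ 2) * 4 <= (C + L ^ 2) * (4 + 8 * s - 8 * s ^ 2)).
    { apply Rmult_le_compat_l; nra. }
    rewrite <- (pow2_abs L) in *.
    pose proof (pow2_ge_0 (2 * Rabs L - 15 * k)). nra. }
  rewrite <- E in HR.
  apply Rmult_lt_reg_l with (x * x + y * y); [exact H|].
  rewrite Rmult_0_r.
  replace (x ^ 2 + y ^ 2) with (x * x + y * y) in HR by ring.
  eapply Rle_lt_trans; [right | exact HR]. field; lra.
Qed.

Lemma barrier_ge C x y : 0 < C -> 0 <= y -> 0 < x * x + y * y ->
  C + logsq x y ^ 2 <= barrier C x y.
Proof.
  intros HC Hy H. pose proof (sine_bounds x y Hy H).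
  unfold barrier; cbv zeta. pose proof (pow2_ge_0 (logsq x y)).
  rewrite <- (Rmult_1_r (C + _)) at 1.
  apply Rmult_le_compat_l; nra.
Qed.

Lemma barrier_blowup C A : 0 < C ->
  exists N, 1 <= N /\ forall x y, 0 <= y -> 0 < x * x + y * y ->
    N <= Rabs (logsq x y) -> A < barrier C x y.
Proof.
  intros HC. exists (1 + Rabs A). pose proof (Rabs_pos A).
  split; [lra|]. intros x y Hy Hxy HN.
  pose proof (barrier_ge C x y HC Hy Hxy) as Hb.
  rewrite <- pow2_abs in Hb. pose proof (Rle_abs A). nra.
Qed.

Lemma abs_coord_lt_of_logsq x y N : 0 < N -> 0 < x * x + y * y ->
  Rabs (logsq x y) < N -> Rabs x < exp N /\ Rabs y < exp N.
Proof.
  intros HN H HL. apply Rabs_def2 in HL.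
  assert (Hlt : x * x + y * y < exp N).
  { rewrite <- (exp_ln (x * x + y * y)) by exact H. apply exp_increasing, HL. }
  assert (H1 : 1 < exp N) by (rewrite <- exp_0; apply exp_increasing; lra).
  split; apply Rnot_le_lt; intros Hle;
    [pose proof (pow2_abs x) | pose proof (pow2_abs y)]; nra.
Qed.

Lemma logsq_near_origin N : 0 < N ->
  locally (0, 0) (fun p : R * R => 0 < fst p * fst p + snd p * snd p ->
    N <= Rabs (logsq (fst p) (snd p))).
Proof.
  intros HN. pose proof (exp_pos (- N)) as He.
  assert (H1 : exp (- N) < 1) by (rewrite <- exp_0; apply exp_increasing; lra).
  exists (mkposreal (exp (- N) / 2) (Rdiv_lt_0_compat _ _ He Rlt_0_2)).
  intros [x y] [Hx Hy] Hp; cbn [fst snd] in *.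
  change (Rabs (x - 0) < exp (- N) / 2) in Hx.
  change (Rabs (y - 0) < exp (- N) / 2) in Hy.
  rewrite Rminus_0_r in Hx, Hy. apply Rabs_def2 in Hx, Hy.
  assert (Hlt : logsq x y < - N).
  { rewrite <- (ln_exp (- N)). apply ln_increasing; [exact Hp | nra]. }
  rewrite Rabs_left; lra.
Qed.

Lemma barrier_continuous C x y : 0 < x * x + y * y ->
  filterlim (fun p : R * R => barrier C (fst p) (snd p))
    (locally (x, y)) (locally (barrier C x y)).
Proof.
  intros H. apply (continuity_2d_pt_filterlim (barrier C) x y).
  pose proof (radius_pos x y H).
  assert (Hq : continuity_2d_pt (fun u v => u * u + v * v) x y).
  { apply continuity_2d_pt_plus; apply continuity_2d_pt_mult;
      auto using continuity_2d_pt_id1, continuity_2d_pt_id2. }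
  assert (HL : continuity_2d_pt logsq x y).
  { apply (continuity_1d_2d_pt_comp ln); [|exact Hq].
    apply continuity_pt_filterlim, continuous_ln, H. }
  assert (Hs : continuity_2d_pt (fun u v => v * / radius u v) x y).
  { apply continuity_2d_pt_mult; [apply continuity_2d_pt_id2|].
    apply continuity_2d_pt_inv; [|lra].
    apply (continuity_1d_2d_pt_comp sqrt); [|exact Hq].
    apply continuity_pt_sqrt; lra. }
  unfold barrier, Rdiv; cbv zeta; simpl pow.
  repeat first [exact HL | exact Hs | apply continuity_2d_pt_const
    | apply continuity_2d_pt_minus | apply continuity_2d_pt_plus
    | apply continuity_2d_pt_mult].
Qed.

(** * Phragmen-Lindelof principle for subsolutions *)

(** Derivatives are carried as explicit functions rather than through [Derive], so
that the results apply to [- u] by changing signs. *)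
Section MaximumPrinciple.

Variables (k : R) (u : R * R -> R) (ux uy uxx uyy : R -> R -> R).
Hypothesis k_pos : 0 < k.
Hypothesis u_x : forall x y, 0 < y -> is_derive (fun s => u (s, y)) x (ux x y).
Hypothesis u_y : forall x y, 0 < y -> is_derive (fun t => u (x, t)) y (uy x y).
Hypothesis u_xx : forall x y, 0 < y -> is_derive (fun s => ux s y) x (uxx x y).
Hypothesis u_yy : forall x y, 0 < y -> is_derive (fun t => uy x t) y (uyy x y).
Hypothesis u_subsolution : forall x y, 0 < y ->
  0 <= uxx x y + uyy x y - k * (x * ux x y + y * uy x y) / (x * x + y * y).

(** At an interior local maximum of [u - e w] the gradients of [u] and [e w]
coincide, so the first order terms of the equation cancel and the second
derivatives contradict the strict supersolution inequality for [w]. *)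
Lemma no_interior_max C e x y :
  31 + 57 * k ^ 2 <= C -> 0 < e -> 0 < y ->
  ~ locally (x, y) (fun p => u p - e * barrier C (fst p) (snd p)
                             <= u (x, y) - e * barrier C x y).
Proof.
  intros HC He Hy [d Hd].
  assert (Hpos : forall a b, 0 < b -> 0 < a * a + b * b) by (intros; nra).
  destruct (local_max_derivatives (fun s => u (s, y) - e * barrier C s y)
    (fun s => ux s y - e * barrier_x C s y) x
    (uxx x y - e * barrier_xx C x y)) as [Hx Hxx].
  { apply filter_forall; intros s.
    apply (is_derive_minus (fun s => u (s, y))); [now apply u_x|].
    apply is_derive_scal, is_derive_barrier_x; auto. }
  { apply (is_derive_minus (fun s => ux s y)); [now apply u_xx|].
    apply is_derive_scal, is_derive_barrier_xx; auto. }
  { exists d; intros s Hs. apply (Hd (s, y)). split; [exact Hs | apply ball_center]. }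
  destruct (local_max_derivatives (fun t => u (x, t) - e * barrier C x t)
    (fun t => uy x t - e * barrier_y C x t) y
    (uyy x y - e * barrier_yy C x y)) as [Hyy Hyyy].
  { exists (mkposreal y Hy); intros t Ht. apply Rabs_def2 in Ht.
    change (t - y < y /\ - y < t - y) in Ht.
    assert (0 < t) by lra.
    apply (is_derive_minus (fun t => u (x, t))); [now apply u_y|].
    apply is_derive_scal, is_derive_barrier_y; auto. }
  { apply (is_derive_minus (fun t => uy x t)); [now apply u_yy|].
    apply is_derive_scal, is_derive_barrier_yy; auto. }
  { exists d; intros t Ht. apply (Hd (x, t)). split; [apply ball_center | exact Ht]. }
  pose proof (barrier_supersolution k C x y k_pos HC (Rlt_le _ _ Hy) (Hpos x y Hy)) as Hw.
  pose proof (u_subsolution x y Hy) as Hu.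
  replace (ux x y) with (e * barrier_x C x y) in Hu by lra.
  replace (uy x y) with (e * barrier_y C x y) in Hu by lra.
  replace (k * (x * (e * barrier_x C x y) + y * (e * barrier_y C x y)) / (x * x + y * y))
    with (e * (k * (x * barrier_x C x y + y * barrier_y C x y) / (x * x + y * y)))
    in Hu by (field; specialize (Hpos x y Hy); lra).
  nra.
Qed.

Hypothesis u_continuous : continuous_on closed_half_plane_minus_origin u.
Variable M : R.
Hypothesis u_bounded : forall p, closed_half_plane_minus_origin p -> u p <= M.
Hypothesis u_boundary : forall x, x <> 0 -> u (x, 0) <= 0.

Lemma le_barrier C e p :
  31 + 57 * k ^ 2 <= C -> 0 < e -> closed_half_plane_minus_origin p ->
  u p <= e * barrier C (fst p) (snd p).
Proof.
  intros HC He Hp. apply Rnot_lt_le; intros Hlt.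
  assert (HC0 : 0 < C) by nra.
  set (v := fun q : R * R => u q - e * barrier C (fst q) (snd q)).
  assert (Hpos : forall q, closed_half_plane_minus_origin q ->
    0 < fst q * fst q + snd q * snd q).
  { intros [a b] [_ Hq]. apply sum_sq_pos, Hq. }
  (* Near the origin and near infinity the barrier outweighs the bound on [u]. *)
  assert (Hfar : forall m, exists N, 1 <= N /\ forall q, closed_half_plane_minus_origin q ->
    N <= Rabs (logsq (fst q) (snd q)) -> v q < m).
  { intros m. destruct (barrier_blowup C ((M - m) / e) HC0) as [N [HN Hb]].
    exists N; split; [exact HN|]. intros q Hq HL.
    specialize (Hb _ _ (proj1 Hq) (Hpos q Hq) HL).
    apply (Rmult_lt_compat_l e _ _ He) in Hb.
    replace (e * ((M - m) / e)) with (M - m) in Hb by (field; lra).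
    pose proof (u_bounded q Hq). unfold v. lra. }
  (* A square of half-side [exp N] contains all points where [v] is nonnegative. *)
  destruct (Hfar 0) as [N [HN Hneg]].
  assert (Hbox : forall q, closed_half_plane_minus_origin q -> 0 <= v q ->
    - exp N < fst q < exp N /\ 0 <= snd q < exp N).
  { intros q Hq Hv.
    destruct (abs_coord_lt_of_logsq (fst q) (snd q) N) as [H1 H2]; [lra | auto | |].
    - apply Rnot_le_lt; intros HL. specialize (Hneg q Hq HL); lra.
    - apply Rabs_def2 in H1, H2. split; [lra | split; [apply Hq | lra]]. }
  assert (Hvp : 0 < v p) by (unfold v; lra).
  destruct (Hbox p Hp (Rlt_le _ _ Hvp)) as [Hp1 Hp2].
  destruct (usc_attains_max (- exp N) (exp N) 0 (exp N)
    closed_half_plane_minus_origin v p) as [t [_ [_ [Ht Hmax]]]]; [| lra | lra | exact Hp |].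
  { intros t m _ Ht2 Hvt.
    destruct (classic (t = (0, 0))) as [-> | Ht0].
    - destruct (Hfar m) as [N' [HN' Hm]].
      apply filter_imp with (2 := logsq_near_origin N' ltac:(lra)).
      intros q HL Hq. auto.
    - assert (Ht : closed_half_plane_minus_origin t) by (split; [lra | exact Ht0]).
      assert (Hv : filterlim v (within closed_half_plane_minus_origin (locally t))
                     (locally (v t))).
      { refine (filterlim_comp_2 (F := within closed_half_plane_minus_origin (locally t))
          u (fun q => - (e * barrier C (fst q) (snd q))) Rplus _ _
          (filterlim_plus (u t) (- (e * barrier C (fst t) (snd t))))).
        - apply u_continuous, Ht.
        - refine (filterlim_filter_le_1 _ (filter_le_within _) _).
          destruct t as [a b].
          refine (filterlim_comp _ _ _ (fun q : R * R => barrier C (fst q) (snd q))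
            (fun z => - (e * z)) _ (locally (barrier C a b)) _ _ _).
          + apply barrier_continuous, (Hpos (a, b)), Ht.
          + apply (@ex_derive_continuous R_AbsRing R_NormedModule (fun z => - (e * z))).
            auto_derive; trivial. }
      apply (Hv (fun z => z < m)), locally_open with (D := fun z => z < m);
        [apply open_lt | trivial | auto]. }
  assert (Hmax' : forall q, closed_half_plane_minus_origin q -> v q <= v t).
  { intros q Hq. destruct (Rle_or_lt 0 (v q)) as [Hv | Hv].
    - destruct (Hbox q Hq Hv). apply Hmax; [lra | lra | exact Hq].
    - specialize (Hmax p ltac:(lra) ltac:(lra) Hp). lra. }
  assert (Hvt : 0 < v t) by (specialize (Hmax' p Hp); lra).
  destruct t as [a b]. pose proof Ht as [Hb Hab]. cbn [snd] in Hb.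
  destruct (Rle_lt_or_eq_dec _ _ Hb) as [Hb' | <-].
  - apply (no_interior_max C e a b HC He Hb').
    exists (mkposreal b Hb'); intros [q1 q2] [_ Hq2].
    change (Rabs (q2 - b) < b) in Hq2. apply Rabs_def2 in Hq2.
    apply (Hmax' (q1, q2)). split; [simpl; lra | intros E; injection E; lra].
  - assert (Ha : a <> 0) by (intros ->; now apply Hab).
    pose proof (u_boundary a Ha).
    pose proof (barrier_ge C a 0 HC0 Hb (Hpos _ Ht)).
    pose proof (pow2_ge_0 (logsq a 0)).
    unfold v in Hvt; cbn [fst snd] in Hvt. nra.
Qed.

Lemma subsolution_nonpositive p : closed_half_plane_minus_origin p -> u p <= 0.
Proof.
  intros Hp. apply Rnot_lt_le; intros Hu.
  set (C := 31 + 57 * k ^ 2). assert (HC : 0 < C) by (unfold C; nra).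
  assert (Hw : 0 < barrier C (fst p) (snd p)).
  { destruct p as [x y]. pose proof (barrier_ge C x y HC (proj1 Hp) (sum_sq_pos _ _ (proj2 Hp))).
    pose proof (pow2_ge_0 (logsq x y)). simpl fst; simpl snd; lra. }
  set (w := barrier C (fst p) (snd p)) in *.
  assert (He : 0 < u p / (2 * w)) by (apply Rdiv_lt_0_compat; lra).
  pose proof (le_barrier C _ p (Rle_refl _) He Hp) as H. fold w in H.
  replace (u p / (2 * w) * w) with (u p / 2) in H by (field; lra).
  lra.
Qed.

End MaximumPrinciple.

(** * From the divergence form to the expanded equation *)

Lemma enorm_radius x y : enorm (x, y) = radius x y.
Proof.
  change (sqrt (Rabs x ^ 2 + Rabs y ^ 2) = radius x y).
  rewrite !pow2_abs. unfold radius; f_equal; ring.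
Qed.

Lemma is_derive_weight k (f : R -> R) x y df : 0 < x * x + y * y ->
  is_derive f x df ->
  is_derive (fun s => Rpower (radius s y) (- k) * f s) x
    (Rpower (radius x y) (- k) * (df - k * (x * f x) / (x * x + y * y))).
Proof.
  intros H Hf. pose proof (radius_pos x y H) as Hr.
  pose proof (is_derive_radius x y H : is_derive (fun s : R => radius s y) x _) as Dr.
  unfold Rpower. auto_derive.
  - repeat split; try (eexists; eassumption); lra.
  - rewrite (is_derive_unique (fun s : R => radius s y) x _ Dr).
    rewrite (is_derive_unique (fun s : R => f s) x _ Hf).
    pose proof (radius_sqr x y) as E.
    replace (x * x + y * y) with (radius x y ^ 2) by lra.
    field; lra.
Qed.

Lemma div_weighted_grad k (u : R * R -> R) x y a b :
  0 < x * x + y * y ->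
  is_derive (fun s => Derive (fun s' => u (s', y)) s) x a ->
  is_derive (fun t => Derive (fun t' => u (x, t')) t) y b ->
  div (fun q : R * R =>
         @scal R_AbsRing (prod_ModuleSpace R_AbsRing R_ModuleSpace R_ModuleSpace)
           (Rpower (enorm q) (- k)) (grad u q)) (x, y)
  = Rpower (radius x y) (- k) *
    (a + b - k * (x * fst (grad u (x, y)) + y * snd (grad u (x, y))) / (x * x + y * y)).
Proof.
  intros H Ha Hb.
  pose proof (is_derive_weight k _ x y a H Ha) as Dx.
  pose proof (is_derive_weight k _ y x b ltac:(lra) Hb) as Dy.
  transitivity
    (Rpower (radius x y) (- k) * (a - k * (x * fst (grad u (x, y))) / (x * x + y * y))
     + Rpower (radius y x) (- k) * (b - k * (y * snd (grad u (x, y))) / (y * y + x * x))).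
  - unfold div; apply f_equal2.
    + refine (eq_trans _ (is_derive_unique _ _ _ Dx)).
      apply Derive_ext; intros s.
      rewrite <- enorm_radius; reflexivity.
    + refine (eq_trans _ (is_derive_unique _ _ _ Dy)).
      apply Derive_ext; intros t.
      rewrite (radius_sym t x), <- enorm_radius; reflexivity.
  - rewrite (radius_sym y x). field; lra.
Qed.

Theorem theorem3p1 :
  forall (k : R) (u : R * R -> R),
    0 < k ->
    C2_on half_plane u ->
    Cb_on closed_half_plane_minus_origin u ->
    (forall p : R * R, half_plane p ->
       div (fun q : R * R =>
              @scal R_AbsRing (prod_ModuleSpace R_AbsRing R_ModuleSpace R_ModuleSpace)
                (Rpower (enorm q) (- k)) (grad u q)) p = 0) ->
    (forall x : R, x <> 0 -> u (x, 0) = 0) ->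
    forall p : R * R, closed_half_plane_minus_origin p -> u p = 0.
Proof.
  intros k u Hk HC2 [Hcont [M HM]] Hdiv Hbd p Hp.
  set (ux := fun x y => Derive (fun s => u (s, y)) x).
  set (uy := fun x y => Derive (fun t => u (x, t)) y).
  set (uxx := fun x y => Derive (fun s => ux s y) x).
  set (uyy := fun x y => Derive (fun t => uy x t) y).
  assert (D : forall x y, 0 < y ->
    is_derive (fun s => u (s, y)) x (ux x y) /\ is_derive (fun t => u (x, t)) y (uy x y) /\
    is_derive (fun s => ux s y) x (uxx x y) /\ is_derive (fun t => uy x t) y (uyy x y)).
  { intros x y Hy.
    destruct (HC2 (x, y) Hy) as [_ [H1 [H2 [[_ [H3 _]] [_ [_ [H4 _]]]]]]].
    repeat split; apply Derive_correct; assumption. }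
  assert (E : forall x y, 0 < y ->
    uxx x y + uyy x y - k * (x * ux x y + y * uy x y) / (x * x + y * y) = 0).
  { intros x y Hy. destruct (D x y Hy) as [_ [_ [Dxx Dyy]]].
    pose proof (Hdiv (x, y) Hy) as H.
    rewrite (div_weighted_grad k u x y _ _ ltac:(nra) Dxx Dyy) in H.
    apply Rmult_integral in H. destruct H as [H | H]; [|exact H].
    pose proof (exp_pos (- k * ln (radius x y))). unfold Rpower in H; lra. }
  apply Rle_antisym.
  - refine (subsolution_nonpositive k u ux uy uxx uyy Hk _ _ _ _ _ Hcont M _ _ p Hp).
    1-4: intros x y Hy; apply (D x y Hy).
    + intros x y Hy. right; symmetry; exact (E x y Hy).
    + intros q Hq. exact (Rle_trans _ _ _ (Rle_abs _) (HM q Hq)).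
    + intros x Hx. right; exact (Hbd x Hx).
  - enough (- u p <= 0) by lra.
    refine (subsolution_nonpositive k (fun q => - u q)
      (fun x y => - ux x y) (fun x y => - uy x y)
      (fun x y => - uxx x y) (fun x y => - uyy x y) Hk _ _ _ _ _ _ M _ _ p Hp).
    1-4: intros x y Hy; refine (is_derive_opp _ _ _ _); apply (D x y Hy).
    + intros x y Hy. right.
      rewrite <- Ropp_0, <- (E x y Hy). field; nra.
    + intros q Hq. refine (filterlim_comp _ _ _ u Ropp _ (locally (u q)) _ _ _).
      * exact (Hcont q Hq).
      * exact (filterlim_opp (u q)).
    + intros q Hq. refine (Rle_trans _ _ _ (Rle_abs _) _).
      rewrite Rabs_Ropp. exact (HM q Hq).
    + intros x Hx. rewrite (Hbd x Hx). lra.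
Qed.
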